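(* Let $m\geq 3$, $n\geq 3$ and $x$ be positive integers such that both $m$ and $n$ divide $3x$, and let $h,u$ be positive integers. Suppose the following conditions are satisfied: (i) there exists a $3$-RGDD$(h^u)$; (ii) for each $p\in\{1,2,\ldots,\frac{h(u-1)}{2}\}$, there exists a decomposition of $K_{(x:3)}$ into $r_p$ $C_m$-factors and $s_p$ $C_n$-factors; (iii) there exists an $(m,n)\text{-}\mathrm{HWP}(hx;r_\beta,s_\beta)$. Let $$r_\alpha=\sum_{p=1}^{\frac{h(u-1)}{2}} r_p\quad\text{and}\quad s_\alpha=\sum_{p=1}^{\frac{h(u-1)}{2}} s_p.$$ Then there exists an $(m,n)\text{-}\mathrm{HWP}(hux;r_\alpha+r_\beta,s_\alpha+s_\beta)$.
   Context: A $C_m$-factor of a graph $G$ is a spanning subgraph of $G$ all of whose connected components are cycles of length $m$. A decomposition of a graph is a partition of its edge set into (edge sets of) subgraphs. For integers $m,n\ge 3$, $v\geq 1$ and $r,s\geq 0$, an $(m,n)\text{-}\mathrm{HWP}(v;r,s)$ is a decomposition of the complete graph $K_v$ if $v$ is odd, or of $K_v-F$ for some $1$-factor (perfect matching) $F$ of $K_v$ if $v$ is even, into $r$ $C_m$-factors and $s$ $C_n$-factors. $K_{(h:u)}$ denotes the complete multipartite graph with $u$ parts of size $h$. A $3$-RGDD$(h^u)$ (resolvable group divisible design with block size $3$ and index $1$) is a triple $(\mathcal{V},\mathcal{G},\mathcal{B})$ where $\mathcal{V}$ is a set of size $hu$, $\mathcal{G}$ is a partition of $\mathcal{V}$ into $u>1$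 subsets (called groups) of size $h$, and $\mathcal{B}$ is a collection of $3$-element subsets of $\mathcal{V}$ (called blocks) such that no two distinct elements of the same group lie together in a block, any two elements from different groups lie together in exactly one block, and $\mathcal{B}$ can be partitioned into parallel classes, each element of $\mathcal{V}$ lying in exactly one block of each parallel class. (Such a design has $\frac{h(u-1)}{2}$ parallel classes.) *)

(* Defs.v *)
From mathcomp Require Import all_boot.

Set Implicit Arguments.
Unset Strict Implicit.
Unset Printing Implicit Defensive.

Record sgraph (V : finType) := SGraph {
  edge :> rel V;
  edge_sym : symmetric edge;
  edge_irr : irreflexive edge }.

Section Graphs.
Variable V : finType.
Implicit Types G H : sgraph V.

(* The vertex set is the whole of V, so every subgraph is spanning. *)
Definition spanning_subgraph H G : Prop := subrel H G.

Fact complete_sym : symmetric (fun x y : V => x != y).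
Proof. by move=> x y; rewrite eq_sym. Qed.
Fact complete_irr : irreflexive (fun x y : V => x != y).
Proof. by move=> x; rewrite eqxx. Qed.
Definition complete : sgraph V := SGraph complete_sym complete_irr.

Fact del_edges_sym G H : symmetric (fun x y => G x y && ~~ H x y).
Proof. by move=> x y; rewrite edge_sym (edge_sym H). Qed.
Fact del_edges_irr G H : irreflexive (fun x y => G x y && ~~ H x y).
Proof. by move=> x; rewrite edge_irr. Qed.
Definition del_edges G H : sgraph V :=
  SGraph (@del_edges_sym G H) (@del_edges_irr G H).

Definition component H (x : V) : {set V} := [set y | connect H x y].

(* The subgraph of H induced on C is a cycle of length m; [next c y] is the
   cyclic successor of y in c. Meaningful for m >= 3. *)
Definition induces_cycle (m : nat) H (C : {set V}) : Prop :=
  exists c : seq V,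
    [/\ uniq c, size c = m, c =i C &
        {in C &, forall y z, H y z = (z == next c y) || (y == next c z)}].

Definition cycle_factor (m : nat) G H : Prop :=
  spanning_subgraph H G /\ forall x, induces_cycle m H (component H x).

Definition one_factor G H : Prop :=
  spanning_subgraph H G /\ forall x, #|[set y | H x y]| = 1.

Definition decomposition (I : Type) G (D : I -> sgraph V) : Prop :=
  (forall i, spanning_subgraph (D i) G) /\
  (forall x y, G x y -> exists! i, D i x y).

(* G decomposes into r C_m-factors and s C_n-factors. *)
Definition cycle_decomposable (m n r s : nat) G : Prop :=
  exists D : 'I_r + 'I_s -> sgraph V,
    [/\ decomposition G D,
        forall i : 'I_r, cycle_factor m G (D (inl i)) &
        forall j : 'I_s, cycle_factor n G (D (inr j))].

End Graphs.

(* K_(h:u): u parts of size h; the first coordinate is the part. *)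
Fact multipartite_sym (h u : nat) :
  symmetric (fun x y : 'I_u * 'I_h => x.1 != y.1).
Proof. by move=> x y; rewrite eq_sym. Qed.
Fact multipartite_irr (h u : nat) :
  irreflexive (fun x y : 'I_u * 'I_h => x.1 != y.1).
Proof. by move=> x; rewrite eqxx. Qed.
Definition complete_multipartite (h u : nat) : sgraph ('I_u * 'I_h)%type :=
  SGraph (@multipartite_sym h u) (@multipartite_irr h u).

Definition HWP (m n v r s : nat) : Prop :=
  let K := complete 'I_v in
  if odd v then cycle_decomposable m n r s K
  else exists F : sgraph 'I_v,
    one_factor K F /\ cycle_decomposable m n r s (del_edges K F).

(* Index 1 excludes repeated blocks, so the blocks form a set. *)
Record is_RGDD3 (h u : nat) (V : finType) (G B : {set {set V}}) : Prop := {
  rgdd_points : #|V| = h * u;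
  rgdd_ngroups : 1 < u;
  rgdd_groups : [/\ partition G [set: V], #|G| = u &
                    forall g, g \in G -> #|g| = h];
  rgdd_blocks : forall b, b \in B -> #|b| = 3;
  rgdd_same_group : forall g x y, g \in G -> x \in g -> y \in g -> x != y ->
    forall b, b \in B -> ~~ ((x \in b) && (y \in b));
  rgdd_diff_group : forall g g' x y, g \in G -> g' \in G -> g != g' ->
    x \in g -> y \in g' -> exists! b, [/\ b \in B, x \in b & y \in b];
  rgdd_resolvable : exists P : {set {set {set V}}},
    partition P B /\ forall C, C \in P -> partition C [set: V] }.

Definition RGDD3 (h u : nat) : Prop :=
  exists (V : finType) (G B : {set {set V}}), is_RGDD3 h u G B.

(* Main.v *)
Require Import Defs.
From mathcomp Require Import all_boot.

Set Implicit Arguments.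
Unset Strict Implicit.
Unset Printing Implicit Defensive.

(** Give every point of the RGDD weight [x]. Each block of a parallel class
    becomes a copy of [K_(x:3)], so each parallel class contributes [r_p]
    [C_m]-factors and [s_p] [C_n]-factors, while each group becomes a copy of
    [K_(hx)] that is filled with the given [HWP]. All these placements, as well
    as the final relabelling of the vertices, are instances of one
    construction: the union of copies of a graph [G] on [U] placed on the fibres
    of a map [f], where a coordinate function [q] identifies each fibre with
    [U]. *)

(** * Copies of a graph on the fibres of a map *)

Section Copies.
Variables (W U : finType) (T : eqType) (f : W -> T) (q : W -> U).

Fact copies_sym (G : sgraph U) :
  symmetric (fun w z => (f w == f z) && G (q w) (q z)).
Proof. by move=> w z; rewrite eq_sym edge_sym. Qed.
Fact copies_irr (G : sgraph U) :
  irreflexive (fun w z => (f w == f z) && G (q w) (q z)).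
Proof. by move=> w; rewrite edge_irr andbF. Qed.
Definition copies (G : sgraph U) : sgraph W :=
  SGraph (@copies_sym G) (@copies_irr G).

Definition fibre_coord : Prop :=
  (forall w z, f w = f z -> q w = q z -> w = z) /\
  (forall w a, exists2 z, f z = f w & q z = a).

Hypothesis fq : fibre_coord.

(** The section [g] inverts [q] on the fibre through [w]; it lifts paths and cycles of [U] to that
    fibre. *)
Lemma fibre_section w :
  exists g : U -> W, (forall a, f (g a) = f w) /\ (forall a, q (g a) = a).
Proof.
have ex a : exists z, (f z == f w) && (q z == a).
  by have [z <- <-] := fq.2 w a; exists z; rewrite !eqxx.
by exists (fun a => xchoose (ex a)); split=> a;
  have /andP[/eqP ? /eqP ?] := xchooseP (ex a).
Qed.

Lemma section_coord w (g : U -> W) :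
  (forall a, f (g a) = f w) -> (forall a, q (g a) = a) ->
  forall z, f z = f w -> g (q z) = z.
Proof. by move=> fg qg z fz; apply: fq.1; rewrite ?fg ?qg. Qed.

(** Edges never leave a fibre, and a path in [U] lifts along the section of the fibre. *)
Lemma connect_copies (G : sgraph U) w z :
  connect (copies G) w z = (f w == f z) && connect G (q w) (q z).
Proof.
apply/idP/andP => [/connectP[p + ->]|[/eqP fwz /connectP[p Gp qz]]].
  elim: p w => [|y p IHp] w /=; first by rewrite eqxx connect0.
  case/andP=> /andP[/eqP-> Gwy] /IHp[-> Gyz]; split=> //.
  exact: connect_trans (connect1 Gwy) Gyz.
have [g [fg qg]] := fibre_section w.
have gq := section_coord fg qg.
apply/connectP; exists (map g p); last first.
  by rewrite -(gq z) // qz -{2}(gq w) // last_map.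
rewrite -{1}(gq w) // path_map; apply: sub_path Gp => a b /=.
by rewrite !fg eqxx !qg.
Qed.

(** A component of the copies lies in one fibre and is the image under the section of a component of
    [H], so the section carries the cycle [c] to the required one. *)
Lemma copies_cycle_factor k (G H : sgraph U) :
  cycle_factor k G H -> cycle_factor k (copies G) (copies H).
Proof.
case=> HG cyc; split=> [w z /andP[fwz /HG Gwz]|w]; first exact/andP.
have [g [fg qg]] := fibre_section w.
have gq := section_coord fg qg.
have g_inj : injective g := can_inj qg.
have [c [c_uniq c_size cC Hc]] := cyc (q w).
have memC z : z \in component (copies H) w ->
    exists2 a, a \in component H (q w) & z = g a.
  rewrite inE connect_copies => /andP[/eqP fwz Hwz].
  by exists (q z); rewrite ?inE ?gq.
exists (map g c); split; first by rewrite map_inj_uniq.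
- by rewrite size_map.
- move=> z; apply/mapP/idP => [[a]|/memC[a]].
    by rewrite cC inE => Ha ->; rewrite inE connect_copies fg eqxx qg.
  by rewrite -cC => ca ->; exists a.
move=> _ _ /memC[a Ca ->] /memC[b Cb ->].
by rewrite !next_map // !(inj_eq g_inj) /= !fg eqxx !qg Hc.
Qed.

(** Serves to show that copies of a 1-factor again form a 1-factor. *)
Lemma copies_degree (G : sgraph U) w :
  #|[set z | copies G w z]| = #|[set a | G (q w) a]|.
Proof.
have [g [fg qg]] := fibre_section w.
rewrite -(card_imset _ (can_inj qg)); apply: eq_card => z.
rewrite inE; apply/andP/imsetP => [[/eqP fwz Gwz]|[a]].
  by exists (q z); rewrite ?inE // (section_coord fg qg).
by rewrite inE => Ga ->; rewrite fg qg eqxx.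
Qed.

Lemma copies_cycle_decomposable m n r s (G : sgraph U) :
  cycle_decomposable m n r s G -> cycle_decomposable m n r s (copies G).
Proof.
case=> D [[DG exD] Dr Ds]; exists (fun i => copies (D i)).
split=> [|i|j]; [|exact: copies_cycle_factor..].
split=> [i w z /andP[fwz /DG Gwz]|w z /andP[/= fwz /exD[i [Di uni]]]].
  exact/andP.
exists i; split=> [|j /andP[_ /uni //]]; exact/andP.
Qed.

Lemma copies_del_edges (G H : sgraph U) :
  copies (del_edges G H) =2 del_edges (copies G) (copies H).
Proof. by move=> w z /=; case: (f w == f z). Qed.

Lemma copies_complete :
  copies (complete U) =2 (fun w z => (f w == f z) && (w != z)).
Proof.
move=> w z /=; case: eqP => //= fwz; congr (~~ _).
by apply/eqP/eqP => [/fq.1|->] //; apply.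
Qed.

End Copies.

(** The coordinate of a point is its rank in the enumeration of its own fibre; points of one fibre
    share that enumeration. *)
Lemma fibre_coord_exists (W U : finType) (T : eqType) (f : W -> T) :
  (forall w, #|[set z | f z == f w]| = #|U|) ->
  exists q : W -> U, fibre_coord f q.
Proof.
move=> cardf; pose A w := [set z | f z == f w].
have Aw w : w \in A w by rewrite inE.
have eqA w z : f w = f z -> A w = A z.
  by move=> fwz; apply/setP=> y; rewrite !inE fwz.
have lt_idx w : index w (enum (A w)) < #|U|.
  by rewrite -(cardf w) cardE index_mem mem_enum.
exists (fun w => enum_val (Ordinal (lt_idx w))); split=> [w z fwz|w a].
  move/enum_val_inj/(congr1 val) => /=; rewrite -(eqA _ _ fwz).
  by apply: (index_inj w); rewrite mem_enum ?Aw ?inE ?fwz.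
have lt_a : enum_rank a < size (enum (A w)) by rewrite -cardE cardf.
pose z := nth w (enum (A w)) (enum_rank a).
have fz : f z = f w.
  by have := mem_nth w lt_a; rewrite mem_enum inE => /eqP.
exists z => //; rewrite -[RHS]enum_rankK; congr enum_val; apply: val_inj => /=.
by rewrite (eqA _ _ fz) index_uniq ?enum_uniq.
Qed.

(** * Edge-disjoint unions of decompositions *)

Section Decompositions.
Variable V : finType.
Implicit Types G H : sgraph V.

Lemma cycle_factorW k G G' H :
  subrel G G' -> cycle_factor k G H -> cycle_factor k G' H.
Proof. by move=> GG' [HG cyc]; split=> // y z /HG/GG'. Qed.

Lemma cycle_decomposable_eq m n r s G G' :
  G =2 G' -> cycle_decomposable m n r s G -> cycle_decomposable m n r s G'.
Proof.
move=> eqG; have sG : subrel G G' by move=> y z; rewrite eqG.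
case=> D [[DG exD] Dr Ds]; exists D; split=> [|i|j]; last 2 first.
- exact: cycle_factorW sG (Dr i).
- exact: cycle_factorW sG (Ds j).
split=> [i y z /DG/sG //|y z]; rewrite -eqG; exact: exD.
Qed.

Lemma decomposition_reindex (I J : Type) G (D : I -> sgraph V) (e : J -> I) :
  bijective e -> decomposition G D -> decomposition G (fun j => D (e j)).
Proof.
case=> d ed de [DG exD]; split=> // y z /exD[i [Di uni]].
by exists (d i); split=> [|j /uni ->]; rewrite ?de.
Qed.

Lemma decomposition_union (I J : Type) G G1 G2
    (D1 : I -> sgraph V) (D2 : J -> sgraph V) :
  G =2 (fun y z => G1 y z || G2 y z) -> (forall y z, ~~ (G1 y z && G2 y z)) ->
  decomposition G1 D1 -> decomposition G2 D2 ->
  decomposition G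
    (fun k : I + J => match k with inl i => D1 i | inr j => D2 j end).
Proof.
move=> eqG disj [DG1 ex1] [DG2 ex2]; split.
  by case=> i y z Di; rewrite eqG ?(DG1 _ _ _ Di) ?(DG2 _ _ _ Di) ?orbT.
move=> y z; rewrite eqG; have := disj y z.
case: (boolP (G1 y z)) => [/ex1[i [Di uni]] /= NG2 _|NG1 _ /= /ex2[j [Dj unj]]].
  exists (inl i); split=> // -[i' /uni-> //|j' /DG2]; by rewrite (negPf NG2).
exists (inr j); split=> // -[i' /DG1|j' /unj-> //]; by rewrite (negPf NG1).
Qed.

Lemma cycle_decomposable_union m n r1 s1 r2 s2 G G1 G2 :
  G =2 (fun y z => G1 y z || G2 y z) -> (forall y z, ~~ (G1 y z && G2 y z)) ->
  cycle_decomposable m n r1 s1 G1 -> cycle_decomposable m n r2 s2 G2 ->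
  cycle_decomposable m n (r1 + r2) (s1 + s2) G.
Proof.
move=> eqG disj [D1 [dec1 Dr1 Ds1]] [D2 [dec2 Dr2 Ds2]].
(* [e] regroups the indices by the decomposition they come from, while [inl] and [inr] keep marking
   the cycle length. *)
pose e (k : 'I_(r1 + r2) + 'I_(s1 + s2)) :
    ('I_r1 + 'I_s1) + ('I_r2 + 'I_s2) :=
  match k with
  | inl i => match split i with inl i1 => inl (inl i1) | inr i2 => inr (inl i2) end
  | inr j => match split j with inl j1 => inl (inr j1) | inr j2 => inr (inr j2) end
  end.
have bij_e : bijective e.
  exists (fun k => match k with
    | inl (inl i1) => inl (unsplit (inl i1)) | inr (inl i2) => inl (unsplit (inr i2))
    | inl (inr j1) => inr (unsplit (inl j1)) | inr (inr j2) => inr (unsplit (inr j2))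
    end).
    by case=> i; rewrite /e -{2}[i]splitK; case: (split i).
  by case=> -[] i; rewrite /e unsplitK.
have sG1 : subrel G1 G by move=> y z G1yz; rewrite eqG G1yz.
have sG2 : subrel G2 G by move=> y z G2yz; rewrite eqG G2yz orbT.
exists (fun k => match e k with inl i => D1 i | inr j => D2 j end); split.
- exact: decomposition_reindex bij_e (decomposition_union eqG disj dec1 dec2).
- by move=> i /=; case: (split i) => j /=;
    [apply: cycle_factorW sG1 _ | apply: cycle_factorW sG2 _].
- by move=> i /=; case: (split i) => j /=;
    [apply: cycle_factorW sG1 _ | apply: cycle_factorW sG2 _].
Qed.

Fact has_edge_sym (I : Type) (F : I -> sgraph V) (t : seq I) :
  symmetric (fun y z => has (fun p => F p y z) t).
Proof. by move=> y z; apply: eq_has => p; rewrite edge_sym. Qed.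
Fact has_edge_irr (I : Type) (F : I -> sgraph V) (t : seq I) :
  irreflexive (fun y z => has (fun p => F p y z) t).
Proof. by move=> y; elim: t => //= p t ->; rewrite edge_irr. Qed.
Definition union_graph (I : Type) (F : I -> sgraph V) (t : seq I) : sgraph V :=
  SGraph (@has_edge_sym I F t) (@has_edge_irr I F t).

Lemma cycle_decomposable_bigunion (I : eqType) m n (r s : I -> nat)
    (F : I -> sgraph V) (t : seq I) :
  uniq t ->
  {in t &, forall p p' y z, F p y z -> F p' y z -> p = p'} ->
  {in t, forall p, cycle_decomposable m n (r p) (s p) (F p)} ->
  cycle_decomposable m n (\sum_(p <- t) r p) (\sum_(p <- t) s p)
    (union_graph F t).
Proof.
elim: t => [_ _ _|p t IHt /= /andP[Ntp t_uniq] disj decF].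
  (* The empty union has no edges and the index type is empty, so [complete V] is only a
     placeholder. *)
  rewrite !big_nil; have noI (i : 'I_0 + 'I_0) : False by case: i => -[].
  exists (fun=> complete V); split=> [|[] //|[] //].
  by split=> // i; case: (noI i).
rewrite !big_cons.
apply: (cycle_decomposable_union (G1 := F p) (G2 := union_graph F t)) => //.
- move=> y z; apply/andP => -[Fp /hasP[p' tp' Fp']].
  move: Ntp; rewrite (disj p p' _ _ y z) ?tp' //; first by rewrite mem_head.
  by rewrite inE tp' orbT.
- by apply: decF; rewrite mem_head.
apply: IHt => // [p1 p2 tp1 tp2|p1 tp1].
  by apply: disj; rewrite inE ?tp1 ?tp2 orbT.
by apply: decF; rewrite inE tp1 orbT.
Qed.

End Decompositions.

(* Treats both parities at once: the removed graph is empty when [v] is odd and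
   a 1-factor when [v] is even. *)
Lemma HWP_leave m n v r s :
  HWP m n v r s <->
  exists F : sgraph 'I_v, (forall w, #|[set z | F w z]| = ~~ odd v) /\
    cycle_decomposable m n r s (del_edges (complete 'I_v) F).
Proof.
rewrite /HWP; case: (odd v) => /=; split.
- move=> dec; have irr : irreflexive (fun _ _ : 'I_v => false) by [].
  have sym : symmetric (fun _ _ : 'I_v => false) by [].
  exists (SGraph sym irr); split=> [w|].
    by apply: eq_card0 => z; rewrite inE.
  by apply: cycle_decomposable_eq dec => w z; rewrite /= andbT.
- case=> F [F0]; apply: cycle_decomposable_eq => w z /=.
  by have /card0_eq/(_ z) := F0 w; rewrite !inE => ->; rewrite andbT.
- by case=> F [[_ F1] dec]; exists F.
(* Having no loops, [F] is automatically a subgraph of the complete graph. *)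
- case=> F [F1 dec]; exists F; split=> //; split=> // w z Fwz.
  by apply/eqP => wz; move: Fwz; rewrite wz edge_irr.
Qed.

(** * Groups and parallel classes of the design *)

Section RGDD.
Context {h u : nat} {V : finType} {G B : {set {set V}}}.
Hypothesis design : is_RGDD3 h u G B.

Lemma group_part : partition G [set: V].
Proof. by case: (rgdd_groups design). Qed.

Lemma group_mem v : pblock G v \in G.
Proof. by rewrite pblock_mem // (cover_partition group_part). Qed.

Lemma group_self v : v \in pblock G v.
Proof. by rewrite mem_pblock (cover_partition group_part). Qed.

Lemma card_group v : #|pblock G v| = h.
Proof. by case: (rgdd_groups design) => _ _; apply; exact: group_mem. Qed.

Variable P : {set {set {set V}}}.
Hypothesis partP : partition P B.
Hypothesis classP : forall C, C \in P -> partition C [set: V].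

Lemma class_block C v : C \in P -> pblock C v \in C.
Proof. by move=> PC; rewrite pblock_mem // (cover_partition (classP PC)). Qed.

Lemma class_self C v : C \in P -> v \in pblock C v.
Proof. by move=> PC; rewrite mem_pblock (cover_partition (classP PC)). Qed.

Lemma class_sub C b : C \in P -> b \in C -> b \in B.
Proof.
by move=> PC Cb; rewrite -(cover_partition partP); apply/bigcupP; exists C.
Qed.

Lemma class_eq C b v : C \in P -> b \in C -> v \in b -> pblock C v = b.
Proof. by move=> PC; apply: def_pblock; case/and3P: (classP PC). Qed.

Lemma card_class_block C v : C \in P -> #|pblock C v| = 3.
Proof.
by move=> PC; apply: (rgdd_blocks design); apply: class_sub (class_block _ _).
Qed.

Lemma same_block_diff_group C v w :
  C \in P -> v != w -> pblock C v = pblock C w -> pblock G v != pblock G w.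
Proof.
move=> PC vw eqC; apply/eqP => eqG.
have Gw : w \in pblock G v by rewrite eqG group_self.
have /negP[] := rgdd_same_group design (group_mem v) (group_self v) Gw vw
  (class_sub PC (class_block v PC)).
by rewrite class_self // eqC class_self.
Qed.

(** The block through [v] and [w] lies in some class, because the classes cover [B]. *)
Lemma diff_group_class v w : pblock G v != pblock G w ->
  exists2 C, C \in P & pblock C v = pblock C w.
Proof.
move=> neqG; have [b [[Bb bv bw] _]] := rgdd_diff_group design (group_mem v)
  (group_mem w) neqG (group_self v) (group_self w).
have: b \in cover P by rewrite (cover_partition partP).
by case/bigcupP=> C PC Cb; exists C; rewrite // !(class_eq PC Cb).
Qed.

(** Both classes contain the only block through [v] and [w], and distinct classes are disjoint. *)
Lemma common_class_unique C C' v w :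
  C \in P -> C' \in P -> v != w ->
  pblock C v = pblock C w -> pblock C' v = pblock C' w -> C = C'.
Proof.
move=> PC PC' vw eqC eqC'; have neqG := same_block_diff_group PC vw eqC.
have [b [_ unb]] := rgdd_diff_group design (group_mem v)
  (group_mem w) neqG (group_self v) (group_self w).
have bC D : D \in P -> pblock D v = pblock D w -> b = pblock D v.
  move=> PD eqD; apply: unb; split; last by rewrite eqD class_self.
    exact: class_sub PD (class_block _ PD).
  exact: class_self.
have Cb : b \in C by rewrite (bC C) // class_block.
have C'b : b \in C' by rewrite (bC C') // class_block.
have tP : trivIset P by case/and3P: partP.
by rewrite -(def_pblock tP PC Cb) (def_pblock tP PC' C'b).
Qed.

(* Every class joins a fixed point [v] to exactly two points, and over all
   classes these cover each point outside the group of [v] exactly once. *)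
Lemma card_classes : 0 < h -> #|P| * 2 = h * (u - 1).
Proof.
(* Positivity of [h] provides the fixed point [v]. *)
move=> h_gt0; have : 0 < #|V|.
  by rewrite (rgdd_points design) muln_gt0 h_gt0 (ltnW (rgdd_ngroups design)).
case/card_gt0P=> v _.
have -> : h * (u - 1) = #|~: pblock G v|.
  rewrite cardsCs setCK card_group (rgdd_points design).
  by rewrite mulnBr muln1.
pose joins C w := (v != w) && (pblock C v == pblock C w).
have <- : \sum_(C in P) \sum_(w | joins C w) 1 = #|P| * 2.
  rewrite -sum_nat_const; apply: eq_bigr => C PC.
  rewrite sum1_card -[2]/(3.-1) -(card_class_block v PC).
  rewrite (cardsD1 v (pblock C v)) class_self //=.
  apply: eq_card => w; rewrite !inE [w == v]eq_sym; congr (_ && _).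
  rewrite -eq_pblock; first by [].
    by case/and3P: (classP PC).
  by rewrite (cover_partition (classP PC)) inE.
(* Double counting: now count, for each [w], the classes joining it to [v]. *)
rewrite (exchange_big_dep predT) //= -sum1_card big_mkcond [RHS]big_mkcond.
apply: eq_bigr => w _ /=; rewrite sum1_card inE.
rewrite -eq_pblock; last 2 first.
- by case/and3P: group_part.
- by rewrite (cover_partition group_part) inE.
case: ifP => [neqG|eqG].
  have [C PC eqC] := diff_group_class neqG.
  have vw : v != w by apply: contraNneq neqG => ->.
  rewrite -[RHS](cards1 C); apply: eq_card => C'.
  rewrite [RHS]inE; apply/andP/eqP => [[PC' /andP[_ /eqP eqC']]|->].
    exact: (common_class_unique PC' PC vw eqC' eqC).
  by rewrite PC /joins vw eqC eqxx.
apply: eq_card0 => C; apply/negP => /andP[PC /andP[vw /eqP eqC]].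
by move: eqG; rewrite (same_block_diff_group PC).
Qed.

End RGDD.

(** * Assembly on the weighted points *)

Theorem lemma14 (m n x h u : nat) (r s : nat -> nat) (rb sb : nat)
  (hm : 3 <= m) (hn : 3 <= n) (hx : 0 < x)
  (hmx : m %| 3 * x) (hnx : n %| 3 * x)
  (hh : 0 < h) (hu : 0 < u)
  (hi : RGDD3 h u)
  (hii : forall p : nat, 1 <= p <= (h * (u - 1)) %/ 2 ->
     cycle_decomposable m n (r p) (s p) (complete_multipartite x 3))
  (hiii : HWP m n (h * x) rb sb) :
  HWP m n (h * u * x)
    (\sum_(1 <= p < ((h * (u - 1)) %/ 2).+1) r p + rb)
    (\sum_(1 <= p < ((h * (u - 1)) %/ 2).+1) s p + sb).
Proof.
have [V [G [B design]]] := hi; have [P [partP classP]] := rgdd_resolvable design.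
have cardP := card_classes design partP classP hh.
have -> : (h * (u - 1)) %/ 2 = #|P| by rewrite -cardP mulnK.
(* The two orders differ by [h * (u - 1) * x], which is even because [h * (u - 1)] is twice the
   number of classes. Hence both systems remove a 1-factor, or neither does. *)
have eq_odd : odd (h * u * x) = odd (h * x).
  by rewrite -(subnK hu) mulnDr muln1 -cardP !oddM oddD oddM andbF.
pose W := (V * 'I_x)%type.
have [qG qGP] : exists q : W -> 'I_(h * x), fibre_coord (fun w => pblock G w.1) q.
  apply: fibre_coord_exists => w; rewrite card_ord -(card_group design w.1).
  rewrite -[X in _ = _ * X](card_ord x) -cardsT -cardsX; apply: eq_card => -[v a].
  rewrite !inE andbT eq_sym eq_pblock ?(cover_partition (group_part design)) //.
  by case/and3P: (group_part design).
(* Classes are numbered from 1, as in the sums; the default [set0] is never reached for [p] between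
   1 and [#|P|]. *)
pose C p := nth set0 (enum P) p.-1.
have range_p p : (p \in index_iota 1 #|P|.+1) = (0 < p <= #|P|).
  by rewrite mem_index_iota ltnS.
have CP p : 0 < p <= #|P| -> C p \in P.
  by case: p => // p; rewrite -mem_enum /C => ltp; rewrite mem_nth // -cardE.
(* Membership in [P] is put under the quantifier, with a constant map as dummy elsewhere, so that
   finite choice gives one function [pos] for all [D]. *)
have ex_pos D : exists q : V -> 'I_3, D \in P -> fibre_coord (pblock D) q.
  case: (boolP (D \in P)) => [PD|_]; last by exists (fun=> ord0).
  have [|q qP] := @fibre_coord_exists V 'I_3 _ (pblock D); last by exists q.
  move=> v; rewrite card_ord -(card_class_block design partP classP v PD).
  apply: eq_card => w; rewrite inE eq_sym eq_pblock //.
    by case/and3P: (classP _ PD).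
  by rewrite (cover_partition (classP _ PD)).
have [pos posP] := fin_all_exists ex_pos.
(* Over each block, the position of the point in the block names the part and the weight coordinate
   the vertex within it. *)
pose K p := copies (fun w : W => pblock (C p) w.1)
  (fun w : W => (pos (C p) w.1, w.2)) (complete_multipartite x 3).
have coordK p : 0 < p <= #|P| -> fibre_coord (fun w : W => pblock (C p) w.1)
    (fun w : W => (pos (C p) w.1, w.2)).
  move=> /CP/posP[inj sur]; split=> [[v a] [w b] /= eqC [eqpos ->]|[v a] [i b]].
    by rewrite (inj v w).
  by have [w eqC <-] := sur v i; exists (w, b).
have KE p : 0 < p <= #|P| -> K p =2 (fun w z =>
    (w.1 != z.1) && (pblock (C p) w.1 == pblock (C p) z.1)).
  move=> /CP/posP[inj _] w z /=; rewrite andbC.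
  case: (pblock _ _ =P pblock _ _) => [eqC|]; rewrite ?andbF // !andbT.
  by congr (~~ _); apply/eqP/eqP => [/inj->|->].
have C_inj p p' : 0 < p <= #|P| -> 0 < p' <= #|P| -> C p = C p' -> p = p'.
  case: p p' => [|p] [|p'] //= ltp ltp' /eqP.
  by rewrite /C nth_uniq -?cardE ?enum_uniq // => /eqP /= ->.
have [F [F1 decF]] := (HWP_leave _ _ _ _ _).1 hiii.
(* [FW] collects the leaves of all filled groups and becomes the leave of the whole system. *)
pose FW := copies (fun w : W => pblock G w.1) qG F.
have decK : cycle_decomposable m n (\sum_(1 <= p < #|P|.+1) r p)
    (\sum_(1 <= p < #|P|.+1) s p) (union_graph K (index_iota 1 #|P|.+1)).
  apply: cycle_decomposable_bigunion => [|p p'|p]; first exact: iota_uniq.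
    rewrite !range_p => hp hp' w z; rewrite !KE // => /andP[wz /eqP eqC].
    case/andP=> _ /eqP eqC'; apply: C_inj => //.
    exact: (common_class_unique design partP classP) (CP _ hp) (CP _ hp') wz _ _.
  rewrite range_p => hp; apply: copies_cycle_decomposable; first exact: coordK.
  by apply: hii; rewrite -cardP mulnK.
have decW : cycle_decomposable m n (\sum_(1 <= p < #|P|.+1) r p + rb)
    (\sum_(1 <= p < #|P|.+1) s p + sb) (del_edges (complete W) FW).
  (* Distinct points over one group are joined only by the filling, minus [FW]; points over
     different groups are joined only by the [K p] of the class containing their common block. *)
  apply: cycle_decomposable_union decK (copies_cycle_decomposable qGP decF).
    move=> w z; rewrite copies_del_edges /= -/(FW w z).
    have := copies_complete qGP w z; rewrite /= => ->.
    case: (pblock G w.1 =P pblock G z.1) => [eqG|/eqP neqG] /=.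
      suff /negPf-> : ~~ has (fun p => K p w z) (index_iota 1 #|P|.+1) by [].
      apply/hasP => -[p]; rewrite range_p => hp; rewrite KE //.
      case/andP=> wz /eqP eqC.
      by have := same_block_diff_group design partP classP (CP _ hp) wz eqC;
        rewrite eqG eqxx.
    rewrite andbT orbF; have wz1 : w.1 != z.1 by apply: contraNneq neqG => ->.
    have -> : w != z by apply: contraNneq wz1 => ->.
    apply/esym/hasP; have [D PD eqD] := diff_group_class design partP classP neqG.
    have ltD : index D (enum P) < #|P| by rewrite cardE index_mem mem_enum.
    exists (index D (enum P)).+1; first by rewrite range_p.
    by have /= -> := KE (index D (enum P)).+1 ltD w z;
      rewrite /C nth_index ?mem_enum // wz1 eqD eqxx.
  move=> w z; apply/andP => -[/hasP[p]]; rewrite range_p => hp; rewrite KE //.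
  case/andP=> wz /eqP eqC /andP[/eqP eqG _].
  by have := same_block_diff_group design partP classP (CP _ hp) wz eqC;
    rewrite eqG eqxx.
have cardW : h * u * x = #|{: W}|.
  by rewrite card_prod card_ord (rgdd_points design).
pose e (i : 'I_(h * u * x)) : W := enum_val (cast_ord cardW i).
(* A constant map has a single fibre, so taking copies along the bijection [e] is a mere
   relabelling. *)
have eP : fibre_coord (fun=> tt) e.
  split=> [i j _ /enum_val_inj/cast_ord_inj //|_ w].
  by exists (cast_ord (esym cardW) (enum_rank w));
    rewrite // /e cast_ordKV enum_rankK.
(* Both copying steps preserve degrees, and [eq_odd] matches the degree required at order
   [h * u * x]. *)
apply/HWP_leave; exists (copies (fun=> tt) e FW); split=> [i|].
  by rewrite (copies_degree eP) (copies_degree qGP) F1 eq_odd.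
apply: cycle_decomposable_eq (copies_cycle_decomposable eP decW) => i j.
rewrite copies_del_edges /=; congr (_ && _).
exact: (copies_complete eP i j).
Qed.
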